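(* Let $\mathbb{F}_q$ be the finite field of order $q$, let $m_1,\dots,m_\ell$ be positive integers coprime to $q$, let $n=m_1+\cdots+m_\ell$, and let $\Lambda=(\lambda_1,\dots,\lambda_\ell)$ with all $\lambda_i\in\mathbb{F}_q\setminus\{0\}$. Let $\mathcal{C}$ be a $\Lambda$-multi-twisted code of length $n$ over $\mathbb{F}_q$ with constituents $\mathcal{C}_1,\mathcal{C}_2,\dots,\mathcal{C}_r$. For $\delta_w=(\delta_{w,1},\delta_{w,2},\dots,\delta_{w,\ell})\in\mathcal{C}_w$ with $1\le w\le r$, define for $1\le i\le\ell$ $$c_i(\delta_1,\dots,\delta_r)=\frac{1}{m_i}\left(\sum_{w=1}^{r}Tr_{F_w/\mathbb{F}_q}(\delta_{w,i}),\ \sum_{w=1}^{r}Tr_{F_w/\mathbb{F}_q}(\delta_{w,i}\alpha_w^{-1}),\ \dots,\ \sum_{w=1}^{r}Tr_{F_w/\mathbb{F}_q}\left(\delta_{w,i}\alpha_w^{-(m_i-1)}\right)\right)\in\mathbb{F}_q^{m_i}.$$ Then $$\mathcal{C}=\left\{\left(c_1(\delta_1,\dots,\delta_r),c_2(\delta_1,\dots,\delta_r),\dots,c_\ell(\delta_1,\dots,\delta_r)\right):\ \delta_w=(\delta_{w,1},\dots,\delta_{w,\ell})\in\mathcal{C}_w\text{ for }1\le w\le r\right\}.$$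
   Context: Let $V=\prod_{i=1}^{\ell}V_i$ with $V_i=\mathbb{F}_q[x]/\langle x^{m_i}-\lambda_i\rangle$, an $\mathbb{F}_q[x]$-module; $\mathbb{F}_q^n$ is identified with $V$ by sending $(a_{1,0},\dots,a_{1,m_1-1};\dots;a_{\ell,0},\dots,a_{\ell,m_\ell-1})$ to $(a_1(x),\dots,a_\ell(x))$ with $a_i(x)=\sum_{j=0}^{m_i-1}a_{i,j}x^j$. A $\Lambda$-multi-twisted code of length $n$ over $\mathbb{F}_q$ is an $\mathbb{F}_q[x]$-submodule of $V$. Let $g_1(x),\dots,g_r(x)$ be all the distinct irreducible factors (up to scalars) of the polynomials $x^{m_1}-\lambda_1,\dots,x^{m_\ell}-\lambda_\ell$ over $\mathbb{F}_q$; let $\epsilon_{w,i}=1$ if $g_w(x)$ divides $x^{m_i}-\lambda_i$ and $\epsilon_{w,i}=0$ otherwise; let $F_w=\mathbb{F}_q[x]/\langle g_w(x)\rangle$, and let $\alpha_w$ be a fixed zero of $g_w(x)$ in $F_w$. $Tr_{F_w/\mathbb{F}_q}$ is the trace map from $F_w$ to $\mathbb{F}_q$. The constituents of $\mathcal{C}$ are the $F_w$-linear codes of length $\ell$ given by $\mathcal{C}_w=\mathrm{Span}_{F_w}\{(\epsilon_{w,1}a_{1}(\alpha_w),\dots,\epsilon_{w,\ell}a_{\ell}(\alpha_w)):(a_1(x),\dots,a_\ell(x))\in\mathcal{C}\}$ (it suffices to let $(a_1(x),\dots,a_\ell(x))$ run over an $\mathbb{F}_q[x]$-generating set of $\mathcal{C}$).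 In particular, every $\delta_w\in\mathcal{C}_w$ satisfies $\delta_{w,i}=0$ whenever $\epsilon_{w,i}=0$. *)

(* Defs.v *)
From HB Require Import structures.
From mathcomp Require Import all_boot all_order all_fingroup all_algebra.
From mathcomp Require Import all_solvable all_field.

Set Implicit Arguments.
Unset Strict Implicit.
Unset Printing Implicit Defensive.

Import GRing.Theory.
Local Open Scope ring_scope.

Section Trace.
Variables (F : finFieldType) (L : splittingFieldType F).

(* galTrace lands in the copy 1%AS of F inside L; the trace map is its        *)
(* preimage in F (see field_traceE).                                          *)
Definition field_trace (a : L) : F :=
  odflt 0 [pick k : F | k%:A == galTrace 1 {:L} a].

Lemma field_traceE (a : L) : (field_trace a)%:A = galTrace 1 {:L} a.
Proof.
rewrite /field_trace; case: pickP => [k /eqP //|noK].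
have gal1 : galois 1 {:L} by apply: finField_galois; exact: sub1v.
have /vlineP[k Dk] := mem_galTrace gal1 (memvf a).
by have := noK k; rewrite Dk eqxx.
Qed.

End Trace.

Section ResidueField.
Variables (F : finFieldType) (p : {poly F}) (p_irr : irreducible_poly p).

(* {poly %/ h} is the quotient by h only when h is monic, hence the           *)
(* normalisation, which does not change the ideal.                            *)
Lemma monic_irreducible_normalize :
  monic_irreducible_poly ((lead_coef p)^-1 *: p).
Proof.
have lp_neq0 : lead_coef p != 0 by rewrite lead_coef_eq0 irredp_neq0.
have lpV_neq0 : (lead_coef p)^-1 != 0 by rewrite invr_eq0.
split; last by rewrite monicE lead_coefZ mulVf.
case: p_irr => szp irr; split=> [|q szq]; first by rewrite size_scale.
rewrite (eqp_dvdr _ (eqp_scale p lpV_neq0)) => /(irr _ szq) qp.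
by rewrite (eqp_trans qp) // eqp_sym eqp_scale.
Qed.

Definition residue_field : splittingFieldType F :=
  qfpoly_splitting_field_type monic_irreducible_normalize.

End ResidueField.

Section MultiTwisted.
Variables (F : finFieldType) (l : nat) (m : 'I_l -> nat) (lambda : 'I_l -> F).

Definition mt_modulus (i : 'I_l) : {poly F} := 'X^(m i) - (lambda i)%:P.

Lemma mk_monic_mt_modulus i :
  (0 < m i)%N -> mk_monic (mt_modulus i) = mt_modulus i.
Proof.
move=> m_gt0.
by rewrite /mk_monic /mt_modulus size_XnsubC // ltnS m_gt0 monicXnsubC.
Qed.

Definition mt_space : predArgType :=
  {dffun forall i : 'I_l, {poly %/ mt_modulus i}}.

HB.instance Definition _ := Finite.on mt_space.

Implicit Types u v : mt_space.

Definition mt_zero : mt_space := [ffun i => 0].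
Definition mt_opp u : mt_space := [ffun i => - u i].
Definition mt_add u v : mt_space := [ffun i => u i + v i].
Definition mt_scale (f : {poly F}) v : mt_space :=
  [ffun i => in_qpoly (mt_modulus i) f * v i].

Lemma mt_addA : associative mt_add.
Proof. by move=> u v w; apply/ffunP=> i; rewrite !ffunE addrA. Qed.
Lemma mt_addC : commutative mt_add.
Proof. by move=> u v; apply/ffunP=> i; rewrite !ffunE addrC. Qed.
Lemma mt_add0 : left_id mt_zero mt_add.
Proof. by move=> u; apply/ffunP=> i; rewrite !ffunE add0r. Qed.
Lemma mt_addN : left_inverse mt_zero mt_opp mt_add.
Proof. by move=> u; apply/ffunP=> i; rewrite !ffunE addNr. Qed.

HB.instance Definition _ :=
  GRing.isZmodule.Build mt_space mt_addA mt_addC mt_add0 mt_addN.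

Lemma mt_scaleA f g v : mt_scale f (mt_scale g v) = mt_scale (f * g) v.
Proof. by apply/ffunP=> i; rewrite !ffunE in_qpolyM mulrA. Qed.
Lemma mt_scale1 : left_id 1 mt_scale.
Proof. by move=> v; apply/ffunP=> i; rewrite !ffunE in_qpoly1 mul1r. Qed.
Lemma mt_scaleDr : right_distributive mt_scale +%R.
Proof. by move=> f u v; apply/ffunP=> i; rewrite !ffunE mulrDr. Qed.
Lemma mt_scaleDl v : {morph mt_scale^~ v : f g / f + g}.
Proof. by move=> f g; apply/ffunP=> i; rewrite !ffunE in_qpolyD mulrDl. Qed.

HB.instance Definition _ := GRing.Zmodule_isLmodule.Build {poly F} mt_space
  mt_scaleA mt_scale1 mt_scaleDr mt_scaleDl.

Definition mt_block_poly (a : 'rV[F]_(\sum_i m i)) (i : 'I_l) : {poly F} :=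
  rVpoly (submxrow a i).

(* The identification of F^n, n = \sum_i m i, with mt_space.                  *)
Definition mt_of_row (a : 'rV[F]_(\sum_i m i)) : mt_space :=
  [ffun i => in_qpoly (mt_modulus i) (mt_block_poly a i)].

Lemma mt_of_row_bij : (forall i, (0 < m i)%N) -> bijective mt_of_row.
Proof.
move=> m_gt0; have szm i : size (mk_monic (mt_modulus i)) = (m i).+1.
  by rewrite mk_monic_mt_modulus ?size_XnsubC.
exists (fun v : mt_space => \mxrow_i poly_rV (v i : {poly F})) => [a|v].
  rewrite -[RHS]submxrowK; apply: eq_mxrow => i.
  by rewrite ffunE in_qpoly_small ?szm ?ltnS ?size_poly // rVpolyK.
apply/ffunP=> i; rewrite ffunE /mt_block_poly mxrowK; apply: val_inj => /=.
have szv : (size (v i : {poly F}) <= m i)%N by rewrite -ltnS -szm size_mk_monic.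
by rewrite poly_rV_K // -[LHS]/(polyn (in_qpoly _ _)) in_qpoly_small ?size_mk_monic.
Qed.

Definition multi_twisted_code (C : {set 'rV[F]_(\sum_i m i)}) : Prop :=
  submod_closed (mt_of_row @: C).

Section Constituent.
Variables (p : {poly F}) (p_irr : irreducible_poly p).
Let Fp := residue_field p_irr.
Variable alpha : Fp.

Definition mt_eval (a : 'rV[F]_(\sum_i m i)) : 'rV[Fp]_l :=
  \row_i (if p %| mt_modulus i
          then (map_poly (in_alg Fp) (mt_block_poly a i)).[alpha] else 0).

Definition constituent (C : {set 'rV[F]_(\sum_i m i)}) : {vspace 'rV[Fp]_l} :=
  <<[seq mt_eval a | a <- enum C]>>%VS.

End Constituent.

Section TraceFormula.
Variables (r : nat) (g : 'I_r -> {poly F}).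
Variables (g_irr : forall w, irreducible_poly (g w)).
Variable alpha : forall w, residue_field (g_irr w).
Variable delta : forall w, 'rV[residue_field (g_irr w)]_l.

Definition trace_block (i : 'I_l) : 'rV[F]_(m i) :=
  (m i)%:R^-1 *: \row_(j < m i)
    \sum_(w < r) field_trace (delta w 0 i * alpha w ^- j).

Definition trace_word : 'rV[F]_(\sum_i m i) := \mxrow_i trace_block i.

End TraceFormula.

End MultiTwisted.

Arguments trace_word {F l m r g g_irr} alpha delta.

(* Main.v *)
Require Import Defs.
From HB Require Import structures.
From mathcomp Require Import all_boot all_order all_fingroup all_algebra.
From mathcomp Require Import all_solvable all_field.
From mathcomp Require Import ring zify.

Set Implicit Arguments.
Unset Strict Implicit.
Unset Printing Implicit Defensive.

(* Since x^m - lambda is separable, it is up to a scalar the product of the   *)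
(* g_w dividing it, so \sum_w Tr(alpha_w^k) is the k-th power sum of the      *)
(* roots of x^m - lambda, namely m if k = 0 and 0 if 0 < k < m.  Hence the    *)
(* trace formula inverts the evaluation c |-> (c(alpha_w))_w on the whole     *)
(* space.  Conversely, a polynomial with a prescribed value at alpha_w and    *)
(* vanishing at the other alpha_v acts on C so as to realise any family of    *)
(* elements of the constituents as the evaluations of a single codeword.      *)

Import GRing.Theory.
Local Open Scope ring_scope.

(** The trace formula is a left inverse of evaluation at the [alpha w] ([trace_word_mt_eval],
    resting on the orthogonality relation [sum_trace_exp_div]), so each codeword comes from its own
    evaluations, which lie in the constituents. Conversely, by [mt_code_eval], any family of
    elements of the constituents is the family of evaluations of one codeword, and the trace formula
    returns that codeword. The roots of different [g w] live in different fields, so [sum_trace_exp]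
    finds their power sums as coefficients of a polynomial over [F], computed once from x^m - lambda
    and once from its factors. *)

Lemma size_mul2l_lt (R : idomainType) (p q q' : {poly R}) :
  p != 0 -> (size q < size q')%N -> (size (p * q)%R < size (p * q')%R)%N.
Proof.
move=> p0 qq'; have q'0 : q' != 0 by rewrite -size_poly_gt0 (leq_ltn_trans _ qq').
have [->|q0] := eqVneq q 0.
  by rewrite mulr0 size_poly0 size_poly_gt0 mulf_neq0.
rewrite !size_mul // -ltnS prednK ?addn_gt0 ?size_poly_gt0 ?p0 //.
by rewrite prednK ?addn_gt0 ?size_poly_gt0 ?p0 // ltn_add2l.
Qed.

(** * Power sums of roots via the logarithmic derivative *)

Section PowerSumQuotient.
Variables (R : idomainType) (K : nat).
Implicit Types h S : {poly R}.

(* [S] is the polynomial part of X^K h'/h = \sum_z X^K/(X - z), i.e.          *)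
(* \sum_(k < K) p_k X^(K-1-k) for the power sums p_k of the roots z of [h].   *)
(* Being additive in [h], it yields power sums over all roots of a product    *)
(* although the roots of distinct factors live in different fields.           *)
Definition power_sum_quotient h S :=
  (size ('X^K * h^`() - h * S)%R < size h)%N.

Lemma power_sum_quotient1 : power_sum_quotient 1 0.
Proof.
rewrite /power_sum_quotient -polyC1 derivC !mulr0 subr0.
by rewrite size_poly0 size_polyC oner_eq0.
Qed.

(** By the Leibniz rule the remainder of the product is R1 h2 + h1 R2, where R1 and R2 are the
    remainders of the factors. *)
Lemma power_sum_quotientM h1 h2 S1 S2 :
  power_sum_quotient h1 S1 -> power_sum_quotient h2 S2 ->
  power_sum_quotient (h1 * h2) (S1 + S2).
Proof.
rewrite /power_sum_quotient => q1 q2.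
have [h1_gt0 h2_gt0] := (leq_ltn_trans (leq0n _) q1, leq_ltn_trans (leq0n _) q2).
have [h1_neq0 h2_neq0] : h1 != 0 /\ h2 != 0 by rewrite -!size_poly_gt0.
have -> : 'X^K * (h1 * h2)^`() - h1 * h2 * (S1 + S2) =
    ('X^K * h1^`() - h1 * S1) * h2 + h1 * ('X^K * h2^`() - h2 * S2).
  by rewrite derivM; ring.
apply: leq_ltn_trans (size_polyD _ _) _; rewrite gtn_max.
by rewrite size_mul2l_lt // mulrC [h1 * h2]mulrC size_mul2l_lt.
Qed.

Lemma power_sum_quotient_prod (I : Type) (s : seq I) (P : pred I)
    (h S : I -> {poly R}) :
  (forall i, P i -> power_sum_quotient (h i) (S i)) ->
  power_sum_quotient (\prod_(i <- s | P i) h i) (\sum_(i <- s | P i) S i).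
Proof.
move=> hS; elim/big_rec2: _ => [|i S' h' Pi]; first exact: power_sum_quotient1.
exact/power_sum_quotientM/hS.
Qed.

Lemma eqp_power_sum_quotient h h' S :
  h %= h' -> power_sum_quotient h S = power_sum_quotient h' S.
Proof.
have scaleE c p : c != 0 ->
    power_sum_quotient (c *: p) S = power_sum_quotient p S.
  move=> c0; rewrite /power_sum_quotient derivZ -scalerAr -scalerAl -scalerBr.
  by rewrite !size_scale.
by case/eqpP=> [[c c'] /andP[c0 c'0] E]; rewrite -(scaleE c) // E scaleE.
Qed.

(** Otherwise [h * (S - S')], a difference of two remainders, would be a nonzero multiple of [h] of
    smaller degree. *)
Lemma power_sum_quotient_inj h S S' :
  power_sum_quotient h S -> power_sum_quotient h S' -> S = S'.
Proof.
rewrite /power_sum_quotient => q q'; apply/eqP; rewrite -subr_eq0.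
apply/negPn/negP => SS'.
have h0 : h != 0 by rewrite -size_poly_gt0 (leq_ltn_trans _ q).
have : (size (h * (S - S'))%R < size h)%N.
  have -> : h * (S - S') =
      ('X^K * h^`() - h * S') - ('X^K * h^`() - h * S) by ring.
  by apply: leq_ltn_trans (size_polyD _ _) _; rewrite size_polyN gtn_max q q'.
by rewrite size_mul // ltnNge -ltnS prednK ?addn_gt0 ?size_poly_gt0 ?h0 //
   -addn1 leq_add2l size_poly_gt0 SS'.
Qed.

(** Geometric sum: (X - z) times the quotient is X^K - z^K, so the remainder is the constant z^K. *)
Lemma power_sum_quotient_XsubC z :
  power_sum_quotient ('X - z%:P) (\sum_(k < K) z ^+ k *: 'X^(K.-1 - k)).
Proof.
rewrite /power_sum_quotient derivXsubC mulr1 size_XsubC ltnS.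
suff -> : ('X - z%:P) * (\sum_(k < K) z ^+ k *: 'X^(K.-1 - k)) =
    'X^K - (z ^+ K)%:P.
  by rewrite opprB addrCA subrr addr0 size_polyC; case: eqP.
rewrite rmorphXn subrXX; congr (_ * _); apply: eq_bigr => k _.
by rewrite -mul_polyC mulrC rmorphXn -subn1 -subnDA add1n.
Qed.

Lemma power_sum_quotient_prodXsubC (I : finType) (P : pred I) (z : I -> R) :
  power_sum_quotient (\prod_(i | P i) ('X - (z i)%:P))
    (\sum_(k < K) (\sum_(i | P i) z i ^+ k) *: 'X^(K.-1 - k)).
Proof.
under [X in power_sum_quotient _ X]eq_bigr do rewrite scaler_suml.
rewrite exchange_big.
by apply: power_sum_quotient_prod => i _; apply: power_sum_quotient_XsubC.
Qed.

End PowerSumQuotient.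

(** The single monomial encodes that, among the first [m.+1] power sums, only the 0-th is possibly
    nonzero. *)
Lemma power_sum_quotient_XnsubC (R : idomainType) m (c : R) :
  power_sum_quotient m.+1 ('X^(m.+1) - c%:P) (m.+1%:R *: 'X^m).
Proof.
rewrite /power_sum_quotient derivB derivC derivXn subr0 size_XnsubC // ltnS.
have -> : 'X^(m.+1) * ('X^m *+ m.+1) - ('X^(m.+1) - c%:P) * (m.+1%:R *: 'X^m) =
    (c * m.+1%:R) *: 'X^m.
  rewrite -!mul_polyC rmorphM /= polyCMn polyC1 -mulr_natl; ring.
by rewrite (leq_trans (size_scale_leq _ _)) // size_polyXn.
Qed.

Lemma map_power_sum_quotient (R R' : fieldType) (f : {rmorphism R -> R'}) K h S :
  power_sum_quotient K (map_poly f h) (map_poly f S) = power_sum_quotient K h S.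
Proof.
rewrite /power_sum_quotient -(map_polyXn f) deriv_map -!rmorphM -rmorphB.
by rewrite !size_map_poly.
Qed.

(** * Linearity of the trace *)

Section Trace.
Variables (F : finFieldType) (L : splittingFieldType F).
Implicit Types (a b : L) (k : F).

Fact field_trace_is_semilinear : semilinear (@field_trace F L : L -> F^o).
Proof.
split=> [k a|a b]; apply: (fmorph_inj (in_alg L)); rewrite /= field_traceE.
  transitivity (k *: (field_trace a)%:A : L); last exact: scalerA.
  by rewrite field_traceE scaler_sumr; apply: eq_bigr => x _; rewrite linearZ.
rewrite scalerDl !field_traceE -big_split.
by apply: eq_bigr => x _; rewrite linearD.
Qed.

HB.instance Definition _ :=
  GRing.isSemilinear.Build F L F^o _ (@field_trace F L) field_trace_is_semilinear.

Lemma field_traceZ k a : field_trace (k *: a) = k * field_trace a.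
Proof. exact: linearZ. Qed.

End Trace.

(** * Roots of irreducible polynomials and their conjugates *)

Section RootOfIrreducible.
Variables (F : finFieldType) (L : splittingFieldType F) (g : {poly F}).
Hypothesis g_irr : irreducible_poly g.
Variable alpha : L.
Hypothesis alpha_root : root (map_poly (in_alg L) g) alpha.

Lemma root_irreducible_dvdp (q : {poly F}) :
  root (map_poly (in_alg L) q) alpha = (g %| q).
Proof.
apply/idP/idP => [qa|gq]; last by apply: root_dvdp alpha_root; rewrite dvdp_map.
apply: contraLR qa; rewrite -irreducible_poly_coprime // => cgq.
by apply: coprimep_root alpha_root; rewrite coprimep_map.
Qed.

(* The [if] is the indicator epsilon_{w,i} of the constituents. *)
Lemma horner_modp_linear (p f a b : {poly F}) :
  let ev q := if g %| p then (map_poly (in_alg L) q).[alpha] else 0 in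
  ev ((f * a) %% p + b) = (map_poly (in_alg L) f).[alpha] * ev a + ev b.
Proof.
rewrite /=; case: ifP => [gp|_]; last by rewrite mulr0 addr0.
have /rootP p0 : root (map_poly (in_alg L) p) alpha.
  by rewrite root_irreducible_dvdp.
rewrite rmorphD hornerD -hornerM -rmorphM [in RHS](divp_eq (f * a) p).
by rewrite rmorphD rmorphM hornerD hornerM /= p0 mulr0 add0r.
Qed.

Lemma root_dvdp_XnsubC n (c : F) : g %| 'X^n - c%:P -> alpha ^+ n = c%:A.
Proof.
rewrite -root_irreducible_dvdp rmorphB /= map_polyXn map_polyC /root !hornerE.
by rewrite subr_eq0 => /eqP.
Qed.

Hypothesis dimL : \dim {:L} = (size g).-1.

(** [g] divides the minimal polynomial of [alpha], so F(alpha) has dimension at least that of [L]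
    and [alpha] generates [L]. *)
Lemma horner_irreducible_root_surj (y : L) :
  exists b : {poly F}, y = (map_poly (in_alg L) b).[alpha].
Proof.
apply/Fadjoin1_polyP; suff -> : <<1; alpha>>%VS = {:L}%VS by rewrite memvf.
apply/eqP; rewrite eqEdim subvf dim_Fadjoin dimv1 muln1 dimL.
have /polyOver1P[q Dq] := minPolyOver 1 alpha.
have := root_minPoly 1 alpha; rewrite Dq root_irreducible_dvdp => gq.
rewrite -ltnS prednK ?size_poly_gt0 ?irredp_neq0 // -size_minPoly.
rewrite Dq size_map_poly dvdp_leq // -(map_poly_eq0 (in_alg L)) -Dq.
by rewrite monic_neq0 ?monic_minPoly.
Qed.

(** The product is Galois-invariant, hence defined over [F]; it vanishes at [alpha], so [g] divides
    it, and the degrees agree. *)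
Lemma eqp_prod_conjugates :
  map_poly (in_alg L) g %= \prod_(s in 'Gal({:L} / 1)%g) ('X - (s alpha)%:P).
Proof.
set h := \prod_(s in _) _.
have gal1 : galois 1 {:L} by apply: finField_galois; exact: sub1v.
have size_h : size h = size g.
  rewrite /h -big_enum /= size_prod_XsubC -cardE -galois_dim // dimv1 divn1.
  by rewrite dimL prednK ?size_poly_gt0 ?irredp_neq0.
have h_over : h \is a polyOver 1%VS.
  have /galois_fixedField <- := gal1; apply/polyOverP => i.
  apply/fixedFieldP=> [|x galx]; first exact: memvf.
  rewrite -coef_map rmorph_prod; congr (_ : {poly _})`_i.
  rewrite [RHS](reindex_inj (mulIg x)) /=.
  apply: eq_big => [s|s _]; first by rewrite groupMr.
  by rewrite rmorphB /= map_polyX map_polyC galM ?memvf.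
have /polyOver1P[q Dq] := h_over.
rewrite -dvdp_size_eqp ?size_map_poly ?size_h // Dq dvdp_map.
rewrite -root_irreducible_dvdp -Dq.
rewrite /root horner_prod (bigD1 1%g) ?group1 //= gal_id hornerXsubC subrr.
by rewrite mul0r.
Qed.

(** Over [L] the roots of [g] are the conjugates of [alpha], so their k-th power sum is the trace of
    alpha^k. *)
Lemma power_sum_quotient_irreducible K :
  power_sum_quotient K g
    (\sum_(k < K) field_trace (alpha ^+ k) *: 'X^(K.-1 - k)).
Proof.
rewrite -(map_power_sum_quotient (in_alg L)).
rewrite (eqp_power_sum_quotient _ _ eqp_prod_conjugates) rmorph_sum /=.
rewrite (eq_bigr (fun k : 'I_K =>
  (\sum_(s in 'Gal({:L} / 1)%g) s alpha ^+ k) *: 'X^(K.-1 - k))).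
  exact: power_sum_quotient_prodXsubC.
move=> k _; rewrite map_polyZ map_polyXn /= field_traceE.
by congr (_ *: _); apply: eq_bigr => s _; rewrite rmorphXn.
Qed.

End RootOfIrreducible.

(** * Squarefree factorisation of x^m - lambda *)

Section FactorPoly.
Variable F : finFieldType.
Implicit Types p q : {poly F}.

Lemma irreducible_dvdp_exists p :
  (1 < size p)%N -> exists2 q, irreducible_poly q & q %| p.
Proof.
have [n] := ubnP (size p); elim: n p => // n IHn p; rewrite ltnS => le_pn p_gt1.
have [/irreducibleP|] := boolP (irreducibleb p); first by exists p.
rewrite /irreducibleb p_gt1 /= => /forallPn[q]; rewrite negb_imply -ltnNge.
rewrite -Pdiv.Idomain.dvdpE => /andP[qp q_gt1].
have lt_qp : (size q < size p)%N.
  by rewrite (leq_ltn_trans (size_npoly q)) // prednK // ltnW.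
have [||f f_irr fq] := IHn q; rewrite ?(leq_trans lt_qp) //.
by exists f; rewrite ?(dvdp_trans fq).
Qed.

Lemma prod_coprimep_dvdp (I : eqType) (s : seq I) (P : pred I)
    (d : I -> {poly F}) p :
  uniq s -> {in s &, forall i j, i != j -> coprimep (d i) (d j)} ->
  (forall i, P i -> d i %| p) -> \prod_(i <- s | P i) d i %| p.
Proof.
move=> + + dP; elim: s => [|i s IHs] /=; first by rewrite big_nil dvd1p.
move=> /andP[si us] cop; rewrite big_cons.
have ds : \prod_(j <- s | P j) d j %| p.
  by apply: IHs => // j k sj sk; apply: cop; rewrite inE ?sj ?sk orbT.
case: ifP => // Pi; rewrite Gauss_dvdp ?dP // big_seq_cond.
apply: (big_ind (coprimep (d i))) => [|q r|j /andP[sj _]].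
- exact: coprimep1.
- by rewrite coprimepMr => -> ->.
by apply: cop; rewrite ?inE ?eqxx ?sj ?orbT //; apply: contraNneq si => ->.
Qed.

(** An irreducible factor of the cofactor [q] would be associate to some [g i] already in the
    product, so its square would divide [p]. *)
Lemma eqp_prod_irreducible_factors (I : finType) (g : I -> {poly F}) p :
    p != 0 -> (forall q, irreducible_poly q -> ~~ (q * q %| p)) ->
    {in predT &, forall i j, i != j -> coprimep (g i) (g j)} ->
    (forall q, irreducible_poly q -> q %| p -> exists i, q %= g i) ->
  p %= \prod_(i | g i %| p) g i.
Proof.
move=> p0 sqf cop all_g; set d := \prod_(i | _) _.
have dp : d %| p.
  apply: prod_coprimep_dvdp => // [|i j _ _]; last exact: cop.
  exact: index_enum_uniq.
have [q Dp] := dvdpP _ _ dp.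
have [q0 d0] : q != 0 /\ d != 0.
  by apply/andP; rewrite -negb_or -mulf_eq0 -Dp.
have [/eqP/size_poly1P[c c0 Dq]|q_neq1] := eqVneq (size q) 1.
  by rewrite Dp Dq mul_polyC eqp_scale.
have [|f f_irr fq] := @irreducible_dvdp_exists q.
  by rewrite ltn_neqAle eq_sym q_neq1 size_poly_gt0.
have fp : f %| p by rewrite Dp dvdp_mulr.
have [i fi] := all_g f f_irr fp.
case/negP: (sqf f f_irr); rewrite Dp dvdp_mul //.
by rewrite (eqp_dvdl _ fi) /d (bigD1 i) ?dvdp_mulr //= -(eqp_dvdl _ fi).
Qed.

(** A double factor of h = X^m - c divides both h and h', hence the nonzero constant X h' - m h = m
    c. *)
Lemma XnsubC_squarefree m (c : F) q :
  m%:R != 0 :> F -> c != 0 -> irreducible_poly q -> ~~ (q * q %| 'X^m - c%:P).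
Proof.
case: m => [/eqP//|m] m0 c0 q_irr; apply/negP=> qqP.
have [r DP] := dvdpP _ _ qqP.
have qP : q %| 'X^(m.+1) - c%:P by rewrite (dvdp_trans _ qqP) ?dvdp_mulr.
have qP' : q %| ('X^(m.+1) - c%:P)^`().
  have -> : ('X^(m.+1) - c%:P)^`() = (r^`() * q + r * q^`() *+ 2) * q.
    rewrite DP !derivM; ring.
  exact: dvdp_mulIr.
have : q %| (m.+1%:R * c)%:P.
  have -> : (m.+1%:R * c)%:P =
      'X * ('X^(m.+1) - c%:P)^`() - m.+1%:R *: ('X^(m.+1) - c%:P).
    rewrite derivB derivC derivXn subr0 -mulr_natl exprS -mul_polyC polyCM.
    ring.
  by rewrite dvdp_sub ?dvdp_mull // dvdpZr.
case: q_irr => q_gt1 _ /dvdp_leq; rewrite polyC_eq0 mulf_neq0 // => /(_ isT).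
by rewrite size_polyC mulf_neq0 // leqNgt q_gt1.
Qed.

End FactorPoly.

(** * Quotient rings, residue fields and characteristic *)

Lemma in_qpoly_mulE (F : fieldType) (h f : {poly F}) (v : {poly %/ h}) :
  h \is monic -> (1 < size h)%N -> in_qpoly h f * v = (f * v) %% h :> {poly F}.
Proof.
move=> h_monic h_gt1.
have -> : in_qpoly h f * v = in_qpoly h (f * (v : {poly F})).
  rewrite in_qpolyM; congr (_ * _); apply: val_inj.
  by rewrite -[RHS]/(polyn (in_qpoly _ _)) in_qpoly_small ?size_mk_monic.
move: (f * _) => q; rewrite Pdiv.IdomainMonic.modpE //=.
by rewrite /mk_monic h_gt1 h_monic.
Qed.

Section ResidueFieldDim.
Variables (F : finFieldType) (p : {poly F}) (p_irr : irreducible_poly p).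

Lemma dim_residue_field : \dim {:residue_field p_irr} = (size p).-1.
Proof.
have <- : (size (mk_monic ((lead_coef p)^-1 *: p))).-1 = (size p).-1.
  rewrite (mk_monicE (monic_irreducible_normalize p_irr)).
  by rewrite size_scale ?invr_eq0 ?lead_coef_eq0 ?irredp_neq0.
exact: (dim_polyn F).
Qed.

End ResidueFieldDim.

(** The order of [F] is zero in [F] by Lagrange, so n = 0 in [F] would give 1 = 0 by Bezout. *)
Lemma natr_coprime_card_neq0 (F : finFieldType) n :
  coprime n #|F| -> n%:R != 0 :> F.
Proof.
rewrite /coprime => /eqP cop; apply/eqP => n0.
have F0 : #|F|%:R = 0 :> F.
  by have := expg_cardG (in_setT (1 : F)); rewrite FinRing.zmodXgE cardsT.
have [u v E _] := egcdnP n (ltnW (card_finNzRing_gt1 F)).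
move/(congr1 (fun x => x%:R : F)): E.
rewrite gcdnC cop natrD !natrM n0 F0 !mulr0 add0r.
by move/esym/eqP; rewrite oner_eq0.
Qed.

(** * Orthogonality and inversion of the evaluation *)

Section MultiTwistedTrace.
Variables (F : finFieldType) (l : nat) (m : 'I_l -> nat).
Hypothesis m_gt0 : forall i, (0 < m i)%N.
Hypothesis m_coprime : forall i, coprime (m i) #|F|.
Variable lambda : 'I_l -> F.
Hypothesis lambda_neq0 : forall i, lambda i != 0.
Variables (r : nat) (g : 'I_r -> {poly F}).
Hypothesis g_irr : forall w, irreducible_poly (g w).
Hypothesis g_distinct : forall w1 w2, g w1 %= g w2 -> w1 = w2.
Hypothesis g_all : forall (p : {poly F}) i, irreducible_poly p ->
  p %| mt_modulus m lambda i -> exists w, p %= g w.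
Let L w := residue_field (g_irr w).
Variable alpha : forall w, L w.
Hypothesis alpha_root :
  forall w, root (map_poly (in_alg (L w)) (g w)) (alpha w).

Local Notation P := (mt_modulus m lambda).
Local Notation word := 'rV[F]_(\sum_i m i).

Lemma coprimep_factors : {in predT &, forall v w, v != w -> coprimep (g v) (g w)}.
Proof.
move=> v w _ _; rewrite irreducible_poly_coprime //; apply: contraNN => gvw.
apply/eqP/g_distinct/(apply_irredp (g_irr w)) => //.
by case: (g_irr v) => [+ _]; case: eqP => // ->.
Qed.

Lemma sum_trace_exp i k : (k < m i)%N ->
  \sum_(w | g w %| P i) field_trace (alpha w ^+ k) = ((k == 0) * m i)%:R.
Proof.
move=> k_lt; have P0 : P i != 0 by rewrite -size_poly_gt0 size_XnsubC.
have eP : P i %= \prod_(w | g w %| P i) g w.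
  apply: eqp_prod_irreducible_factors => //.
  - by move=> q; apply: XnsubC_squarefree; rewrite ?natr_coprime_card_neq0.
  - exact: coprimep_factors.
  by move=> q q_irr; apply: g_all.
have := @power_sum_quotient_prod F (m i) _ (index_enum _) (fun w => g w %| P i) g
  _ (fun w _ => power_sum_quotient_irreducible (g_irr w) (alpha_root w)
                  (dim_residue_field _) (m i)).
rewrite -(eqp_power_sum_quotient _ _ eP) /mt_modulus => q1.
have q2 : power_sum_quotient (m i) ('X^(m i) - (lambda i)%:P)
    ((m i)%:R *: 'X^((m i).-1)).
  by case: (m i) (m_gt0 i) => // n _; apply: power_sum_quotient_XnsubC.
have := power_sum_quotient_inj q1 q2.
(* This coefficient isolates the k-th power sum. *)
move/(congr1 (fun q : {poly F} => q`_((m i).-1 - k))).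
rewrite exchange_big coef_sum coefZ coefXn.
rewrite (bigD1 (Ordinal k_lt)) //= [X in _ + X]big1 ?addr0 => [|j jk].
  rewrite -scaler_suml coefZ coefXn eqxx mulr1 => ->.
  case: k k_lt => [|k] k_lt; first by rewrite subn0 eqxx mulr1 mul1n.
  rewrite (_ : _ == _ = false) ?mulr0 //.
  by apply/eqP; move: (m_gt0 i) k_lt; lia.
rewrite -scaler_suml coefZ coefXn (_ : _ == _ = false) ?mulr0 //.
apply/eqP => E; case/eqP: jk; apply: val_inj => /=; move: E (ltn_ord j) k_lt; lia.
Qed.

Lemma sum_trace_exp_div i j k : (j < m i)%N -> (k < m i)%N ->
  \sum_(w | g w %| P i) field_trace (alpha w ^+ k * alpha w ^- j) =
  ((k == j) * m i)%:R.
Proof.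
move=> j_lt k_lt.
have alpha0 w : g w %| P i -> alpha w != 0.
  move=> /(root_dvdp_XnsubC (g_irr w) (alpha_root w)) E.
  apply: contraTneq (lambda_neq0 i) => aw.
  move: E; rewrite aw expr0n eqn0Ngt m_gt0 /= => /esym/eqP.
  by rewrite scaler_eq0 oner_eq0 orbF => ->.
have [le_jk|lt_kj] := leqP j k.
  rewrite eqn_leq le_jk andbT -subn_eq0 -sum_trace_exp; last first.
    exact: leq_ltn_trans (leq_subr _ _) k_lt.
  by apply: eq_bigr => w gP; rewrite expfB_cond // (negPf (alpha0 w gP)).
(* For k < j, alpha^m = lambda turns the negative exponent k - j into m + k - j, strictly between 0
   and m. *)
rewrite ltn_eqF // mul0n; transitivity
  ((lambda i)^-1 * \sum_(w | g w %| P i) field_trace (alpha w ^+ (m i + k - j))).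
  rewrite mulr_sumr; apply: eq_bigr => w gP.
  have le_j : (j <= m i + k)%N by rewrite (leq_trans (ltnW j_lt)) ?leq_addr.
  rewrite expfB_cond ?(negPf (alpha0 w gP)) // exprD.
  rewrite (root_dvdp_XnsubC (g_irr w) (alpha_root w) gP) mulr_algl -scalerAl.
  by rewrite field_traceZ mulKf.
rewrite sum_trace_exp; last by move: j_lt lt_kj; lia.
by rewrite (_ : _ == _ = false) ?mulr0 //; apply/eqP; move: j_lt; lia.
Qed.

(** Replaces functional extensionality for the dependent family [delta]. *)
Lemma eq_trace_word (delta delta' : forall w, 'rV[L w]_l) :
  (forall w, delta w = delta' w) ->
  trace_word (m := m) alpha delta = trace_word alpha delta'.
Proof.
move=> eq_delta; apply: eq_mxrow => i; apply: congr1; apply/rowP=> j.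
rewrite [LHS]mxE [RHS]mxE; apply: eq_bigr => w _.
exact: (congr1 (fun d : 'rV[L w]_l => field_trace (d 0 i * alpha w ^- j))
          (eq_delta w)).
Qed.

Lemma trace_word_mt_eval (a : word) :
  trace_word (m := m) alpha (fun w => mt_eval lambda (alpha w) a) = a.
Proof.
rewrite -[RHS]submxrowK; apply: eq_mxrow => i; apply/rowP => j; rewrite !mxE.
pose p := mt_block_poly a i.
have mi0 : (m i)%:R != 0 :> F by apply: natr_coprime_card_neq0.
transitivity ((m i)%:R^-1 * \sum_(w | g w %| P i) \sum_(k < m i)
   p`_k * field_trace (alpha w ^+ k * alpha w ^- j)).
  congr (_ * _); rewrite [RHS]big_mkcond; apply: eq_bigr => w _; rewrite mxE.
  case: ifP => // _; last by rewrite mul0r raddf0.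
  rewrite (@horner_coef_wide _ (m i)) ?size_map_poly ?size_poly //.
  rewrite mulr_suml raddf_sum; apply: eq_bigr => k _.
  by rewrite coef_map /= mulr_algl -scalerAl field_traceZ.
(* Orthogonality keeps only k = j, whose factor [m i] cancels against the inverse in front. *)
rewrite exchange_big (bigD1 j) //= [X in _ + X]big1 ?addr0 => [|k kj].
  rewrite -mulr_sumr sum_trace_exp_div // eqxx mul1n mulrCA mulVf // mulr1.
  by rewrite coef_rVpoly_ord mxE.
by rewrite -mulr_sumr sum_trace_exp_div // val_eqE (negPf kj) mulr0.
Qed.

(** * Realising elements of the constituents by codewords *)

(** Take the product [d] of the other [g v], nonzero at [alpha w] by coprimality, times a polynomial
    with value y / d(alpha w) there. *)
Lemma horner_crt w (y : L w) :
  exists2 f : {poly F}, (map_poly (in_alg (L w)) f).[alpha w] = y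
    & forall v, v != w -> (map_poly (in_alg (L v)) f).[alpha v] = 0.
Proof.
pose d := \prod_(v | v != w) g v.
have d_neq0 : (map_poly (in_alg (L w)) d).[alpha w] != 0.
  rewrite -[_ == 0]/(root _ _) (root_irreducible_dvdp (g_irr w) (alpha_root w)).
  rewrite -irreducible_poly_coprime //.
  apply: (big_ind (coprimep (g w))) => [|p q|v vw]; first exact: coprimep1.
    by rewrite coprimepMr => -> ->.
  by rewrite coprimep_sym coprimep_factors.
have [b Db] := horner_irreducible_root_surj (g_irr w) (alpha_root w)
  (dim_residue_field _) (y / (map_poly (in_alg (L w)) d).[alpha w]).
exists (b * d) => [|v vw]; first by rewrite rmorphM hornerM -Db mulfVK.
apply/rootP; rewrite (root_irreducible_dvdp (g_irr v) (alpha_root v)).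
by rewrite dvdp_mull // /d (bigD1 v) //= dvdp_mulIl.
Qed.

Lemma mt_block_poly_linear i (f : {poly F}) (a b c : word) :
    mt_of_row lambda c = f *: mt_of_row lambda a + mt_of_row lambda b ->
  mt_block_poly c i = (f * mt_block_poly a i) %% P i + mt_block_poly b i.
Proof.
have mt_of_rowE (e : word) :
    mt_of_row lambda e i = mt_block_poly e i :> {poly F}.
  rewrite ffunE in_qpoly_small // mk_monic_mt_modulus //.
  by rewrite size_XnsubC // ltnS size_poly.
move=> Dc; have Dci : mt_of_row lambda c i =
    in_qpoly (P i) f * mt_of_row lambda a i + mt_of_row lambda b i.
  by rewrite Dc [LHS]ffunE [X in X + _]ffunE.
rewrite -!mt_of_rowE Dci -in_qpoly_mulE ?monicXnsubC ?size_XnsubC //.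
by rewrite ltnS.
Qed.

(** The polynomial action lives on [mt_space], not on words, so [c] is given by its image. Reducing
    modulo [P i] is harmless: [P i] vanishes at [alpha w], or the coordinate is set to 0. *)
Lemma mt_eval_linear w (f : {poly F}) (a b c : word) :
    mt_of_row lambda c = f *: mt_of_row lambda a + mt_of_row lambda b ->
  mt_eval lambda (alpha w) c =
  (map_poly (in_alg (L w)) f).[alpha w] *: mt_eval lambda (alpha w) a
    + mt_eval lambda (alpha w) b.
Proof.
move=> Dc; apply/rowP => i; rewrite [RHS]mxE [in RHS]mxE.
have evE (e : word) : mt_eval lambda (alpha w) e 0 i =
    if g w %| P i then (map_poly (in_alg (L w)) (mt_block_poly e i)).[alpha w]
    else 0 by rewrite [LHS]mxE.
pose ev q := if g w %| P i then (map_poly (in_alg (L w)) q).[alpha w] else 0.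
refine (etrans (evE c) (etrans (congr1 ev (mt_block_poly_linear i Dc)) _)).
refine (etrans (horner_modp_linear (g_irr w) (alpha_root w) _ _ _ _) _).
exact: (esym (congr2 +%R (congr1 ( *%R _) (evE a)) (evE b))).
Qed.

Variable C : {set word}.
Hypothesis C_mt : multi_twisted_code lambda C.

Lemma mt_code_linear f a b : a \in C -> b \in C ->
  exists2 c, c \in C
    & forall w, mt_eval lambda (alpha w) c =
        (map_poly (in_alg (L w)) f).[alpha w] *: mt_eval lambda (alpha w) a
        + mt_eval lambda (alpha w) b.
Proof.
move=> aC bC; have [_ C_lin] := C_mt.
have /imsetP[c cC Dc] := C_lin f _ _ (imset_f (mt_of_row lambda) aC)
                                     (imset_f (mt_of_row lambda) bC).
by exists c => // w; apply: mt_eval_linear.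
Qed.

Lemma mt_code0 : exists2 c, c \in C & forall w, mt_eval lambda (alpha w) c = 0.
Proof.
have [/imsetP[a aC _] _] := C_mt.
have [c cC Dc] := mt_code_linear (- 1) aC aC.
exists c => // w; rewrite Dc rmorphN rmorph1 hornerN hornerC scaleN1r.
by rewrite addNr.
Qed.

(** Each coefficient of a spanning combination is the value at [alpha w] of a polynomial vanishing
    at the other [alpha v]; letting it act on a codeword adds that term at [w] and nothing
    elsewhere. *)
Lemma mt_code_eval_single w y : y \in constituent lambda (alpha w) C ->
  exists2 c, c \in C & mt_eval lambda (alpha w) c = y /\
    forall v, v != w -> mt_eval lambda (alpha v) c = 0.
Proof.
pose reached z := exists2 c, c \in C & mt_eval lambda (alpha w) c = z /\
  forall v, v != w -> mt_eval lambda (alpha v) c = 0.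
pose words := [seq mt_eval lambda (alpha w) a | a : word <- enum C].
rewrite -[constituent _ _ _]/(<<in_tuple words>>%VS) => /coord_span ->.
apply: (big_rec reached) => [|i x _ [b bC [<- bv]]].
  by have [c cC Dc] := mt_code0; exists c.
move: (coord _ _ _) => z.
have /mapP[a aC ->] := mem_nth 0 (ltn_ord i); rewrite mem_enum in aC.
have [f <- fv] := horner_crt z; have [c cC Dc] := mt_code_linear f aC bC.
exists c; first exact: cC.
split=> [|v vw]; first exact: Dc.
by rewrite Dc fv // bv // scale0r addr0.
Qed.

Lemma mt_code_eval (delta : forall w, 'rV[L w]_l) :
    (forall w, delta w \in constituent lambda (alpha w) C) ->
  exists2 c, c \in C & forall w, mt_eval lambda (alpha w) c = delta w.
Proof.
move=> deltaC.
(* Generalised to prescribe values on a list of indices and 0 off it, so that they can be added one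
   at a time. *)
suff [c cC Dc] : exists2 c, c \in C & forall w, mt_eval lambda (alpha w) c =
    if w \in enum 'I_r then delta w else 0.
  by exists c => // w; rewrite Dc mem_enum.
elim: (enum 'I_r) (enum_uniq 'I_r) => [_|w s IHs /= /andP[ws /IHs[b bC Db]]].
  exact: mt_code0.
have [a aC [aw av]] := mt_code_eval_single (deltaC w).
have [c cC Dc] := mt_code_linear 1 aC bC.
exists c => // v; rewrite Dc rmorph1 hornerC scale1r Db inE.
have [->|vw] := eqVneq v w; first by rewrite aw (negPf ws) addr0.
by rewrite av // add0r.
Qed.

End MultiTwistedTrace.

Theorem theorem6p2 (F : finFieldType) (l : nat)
    (m : 'I_l -> nat) (m_gt0 : forall i, (0 < m i)%N)
    (m_coprime : forall i, coprime (m i) #|F|)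
    (lambda : 'I_l -> F) (lambda_neq0 : forall i, lambda i != 0)
    (r : nat) (g : 'I_r -> {poly F})
    (g_irr : forall w, irreducible_poly (g w))
    (g_dvd : forall w, exists i, g w %| mt_modulus m lambda i)
    (g_distinct : forall w1 w2, g w1 %= g w2 -> w1 = w2)
    (g_all : forall (p : {poly F}) i, irreducible_poly p ->
       p %| mt_modulus m lambda i -> exists w, p %= g w)
    (alpha : forall w, residue_field (g_irr w))
    (alpha_root : forall w,
       root (map_poly (in_alg (residue_field (g_irr w))) (g w)) (alpha w))
    (C : {set 'rV[F]_(\sum_i m i)})
    (C_mt : multi_twisted_code lambda C) :
  forall c : 'rV[F]_(\sum_i m i),
    c \in C <->
    exists2 delta : forall w, 'rV[residue_field (g_irr w)]_l,
      forall w, delta w \in constituent lambda (alpha w) C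
      & c = trace_word alpha delta.
Proof.
move=> c; have inv := trace_word_mt_eval m_gt0 m_coprime lambda_neq0
  g_distinct g_all alpha_root.
split=> [cC|[delta deltaC ->]].
  exists (fun w => mt_eval lambda (alpha w) c) => [w|]; last by rewrite inv.
  by apply/memv_span/map_f; rewrite mem_enum.
have [a aC Da] := mt_code_eval m_gt0 g_distinct alpha_root C_mt deltaC.
suff <- : a = trace_word alpha delta by exact: aC.
by rewrite -[LHS]inv; apply: eq_trace_word.
Qed.
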